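(* Let $A\in\mathbb{C}^{n\times n}$ have index $k$, let $m$ be a positive integer, let $A_1=AA^{\mathrm{w}_m}A$, and let $X\in\mathbb{C}^{n\times n}$. Then the following conditions are equivalent: (a) $X=A^{\mathrm{w}_m,\dagger}$; (b) $XAX=X$, $AX=A_1A^\dagger$ and $XAA^*=A^{\mathrm{w}_m}AA^*$; (c) $XAX=X$, $AX=A_1A^\dagger$ and $XA^k=A^{\mathrm{w}_m}A^k$; (d) $XAX=X$, $XA=A^{\mathrm{w}_m}A$ and $A^kX=A_1^kA^\dagger$; (e) $XAX=X$, $XA=A^{\mathrm{w}_m}A$ and $A^*AX=A^*A_1A^\dagger$.
   Context: $r(\cdot)$ and $(\cdot)^*$ denote rank and conjugate transpose; $A^\dagger$ is the Moore-Penrose inverse and $A^D$ the Drazin inverse. The index of $A\in\mathbb{C}^{n\times n}$ is the smallest nonnegative integer $k$ with $r(A^{k+1})=r(A^k)$ (zeroth powers of matrices are $I_n$). For $A$ of index $k$, the core-EP inverse is $A^{\mathrm{cEP}}=A^DA^k(A^k)^\dagger$ and the $m$-weak group inverse is $A^{\mathrm{w}_m}=(A^{\mathrm{cEP}})^{m+1}A^m$. The $m$-weak group MP inverse $A^{\mathrm{w}_m,\dagger}$ is the unique $Y\in\mathbb{C}^{n\times n}$ satisfying $YAY=Y$, $AY=A_1A^\dagger$ and $YA=A^DA_1$, where $A_1=AA^{\mathrm{w}_m}A$. *)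

(* Defs.v *)
From mathcomp Require Import all_boot all_order all_algebra spectral.
From mathcomp Require Import classical_sets reals complex.

Set Implicit Arguments.
Unset Strict Implicit.
Unset Printing Implicit Defensive.

Import Order.TTheory GRing.Theory Num.Theory.

Local Open Scope sesquilinear_scope.
Local Open Scope ring_scope.

Section GeneralizedInverses.

Variable C : numClosedFieldType.

Section Index.

Variables (n : nat) (A : 'M[C]_n).

Lemma mxrank_expS k : (\rank (A ^+ k.+1) <= \rank (A ^+ k))%N.
Proof. by rewrite exprS; apply: mxrankM_maxr. Qed.

Lemma mxindex_subproof : exists k, \rank (A ^+ k.+1) == \rank (A ^+ k).
Proof.
case: (boolP [exists k : 'I_n.+1, \rank (A ^+ k.+1) == \rank (A ^+ k)]).
  by case/existsP => k rk; exists k.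
rewrite negb_exists => /forallP rkN; exfalso.
suff: forall k, (k <= n.+1)%N -> (\rank (A ^+ k) + k <= n)%N.
  by move=> /(_ n.+1 (leqnn _)); rewrite leqNgt addnS ltnS leq_addl.
elim=> [|k IHk] ltk; first by rewrite addn0 rank_leq_row.
apply: leq_trans (IHk (ltnW ltk)); rewrite addnS -addSn leq_add2r.
by rewrite ltn_neqAle (rkN (Ordinal ltk)) mxrank_expS.
Qed.

Definition mxindex : nat := ex_minn mxindex_subproof.

End Index.

Definition is_mpinv (p q : nat) (A : 'M[C]_(p, q)) (X : 'M[C]_(q, p)) : Prop :=
  [/\ A *m X *m A = A, X *m A *m X = X,
      (A *m X)^t* = A *m X & (X *m A)^t* = X *m A].

Definition mpinv (p q : nat) (A : 'M[C]_(p, q)) : 'M[C]_(q, p) :=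
  xget 0 [set X | is_mpinv A X]%classic.

Definition is_drazin (n : nat) (A X : 'M[C]_n) : Prop :=
  [/\ X *m A *m X = X, A *m X = X *m A
    & X *m A ^+ (mxindex A).+1 = A ^+ mxindex A].

Definition drazin (n : nat) (A : 'M[C]_n) : 'M[C]_n :=
  xget 0 [set X | is_drazin A X]%classic.

Definition core_ep (n : nat) (A : 'M[C]_n) : 'M[C]_n :=
  drazin A *m A ^+ mxindex A *m mpinv (A ^+ mxindex A).

Definition mweak_group (m n : nat) (A : 'M[C]_n) : 'M[C]_n :=
  core_ep A ^+ m.+1 *m A ^+ m.

(* The matrix A_1 = A A^{w_m} A. *)
Definition mweak_A1 (m n : nat) (A : 'M[C]_n) : 'M[C]_n :=
  A *m mweak_group m A *m A.

Definition is_mweak_group_mp (m n : nat) (A Y : 'M[C]_n) : Prop :=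
  [/\ Y *m A *m Y = Y, A *m Y = mweak_A1 m A *m mpinv A
    & Y *m A = drazin A *m mweak_A1 m A].

Definition mweak_group_mp (m n : nat) (A : 'M[C]_n) : 'M[C]_n :=
  xget 0 [set Y | is_mweak_group_mp m A Y]%classic.

(* The three sets passed to xget above are singletons, so its default value 0
   is never used. *)

Lemma mxindexP (n : nat) (A : 'M[C]_n) :
  \rank (A ^+ (mxindex A).+1) = \rank (A ^+ mxindex A) /\
  forall j, \rank (A ^+ j.+1) = \rank (A ^+ j) -> (mxindex A <= j)%N.
Proof.
rewrite /mxindex; case: ex_minnP => k /eqP rk kmin; split=> // j /eqP.
exact: kmin.
Qed.

Lemma conjtrmxM (p q r : nat) (A : 'M[C]_(p, q)) (B : 'M[C]_(q, r)) :
  (A *m B)^t* = B^t* *m A^t*.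
Proof. by rewrite trmx_mul map_mxM. Qed.

Lemma mul_conjtrmx_eq0 (p q : nat) (A : 'M[C]_(p, q)) :
  A *m A^t* = 0 -> A = 0.
Proof.
move=> AA0; apply/matrixP=> i j; rewrite mxE.
have /eqP := congr1 (fun M : 'M[C]_p => M i i) AA0; rewrite !mxE.
rewrite psumr_eq0 => [/allP/(_ j (mem_index_enum _))|l _].
  by rewrite /= !mxE mul_conjC_eq0 => /eqP.
by rewrite !mxE mul_conjC_ge0.
Qed.

Lemma gram_unitmx (p q : nat) (A : 'M[C]_(p, q)) :
  row_free A -> A *m A^t* \in unitmx.
Proof.
move=> fA; rewrite -row_free_unit -kermx_eq0; apply/eqP.
set K := kermx _; have KA : K *m A *m A^t* = 0.
  by rewrite -mulmxA; apply: mulmx_ker.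
have : K *m A = 0.
  by apply: mul_conjtrmx_eq0; rewrite conjtrmxM mulmxA KA mul0mx.
by move/eqP; rewrite mulmx_free_eq0 // => /eqP.
Qed.

Lemma mpinv_exists (p q : nat) (A : 'M[C]_(p, q)) : exists X, is_mpinv A X.
Proof.
have [r [L [R [AE fL fR]]]] : exists r (L : 'M[C]_(p, r)) (R : 'M[C]_(r, q)),
    [/\ L *m R = A, row_full L & row_free R].
  exists (\rank A), (col_base A), (row_base A).
  by split; [apply: mulmx_base | apply: col_base_full | apply: row_base_free].
have uR : R *m R^t* \in unitmx by apply: gram_unitmx.
have uL : L^t* *m L \in unitmx.
  rewrite -[X in _ *m X]trmxCK; apply: gram_unitmx.
  by rewrite /row_free mxrank_map mxrank_tr.
pose GR := invmx (R *m R^t*); pose GL := invmx (L^t* *m L).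
have GRh : GR^t* = GR.
  by rewrite /GR trmx_inv (map_invmx (Num.conj : {rmorphism C -> C})) conjtrmxM trmxCK.
have GLh : GL^t* = GL.
  by rewrite /GL trmx_inv (map_invmx (Num.conj : {rmorphism C -> C})) conjtrmxM trmxCK.
pose X := R^t* *m GR *m GL *m L^t*.
have AX : A *m X = L *m GL *m L^t*.
  rewrite -AE /X !mulmxA -(mulmxA L R) -(mulmxA L _ GR).
  by rewrite mulmxV // mulmx1.
have XA : X *m A = R^t* *m GR *m R.
  rewrite -AE /X !mulmxA -(mulmxA _ (L^t*) L) -(mulmxA _ GL).
  by rewrite mulVmx // mulmx1.
exists X; split.
- rewrite AX -AE !mulmxA -(mulmxA _ (L^t*) L) -(mulmxA _ GL).
  by rewrite mulVmx // mulmx1.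
- rewrite XA /X !mulmxA -(mulmxA _ R (R^t*)) -(mulmxA _ (R *m _) GR).
  by rewrite mulmxV // mulmx1.
- by rewrite AX !conjtrmxM trmxCK GLh mulmxA.
- by rewrite XA !conjtrmxM trmxCK GRh mulmxA.
Qed.

Lemma mpinv_unique (p q : nat) (A : 'M[C]_(p, q)) X Y :
  is_mpinv A X -> is_mpinv A Y -> X = Y.
Proof.
move=> [X1 X2 X3 X4] [Y1 Y2 Y3 Y4].
have AXY : A *m X = A *m Y.
  by rewrite -X3 -[in LHS]Y1 -mulmxA conjtrmxM X3 Y3 !mulmxA X1.
have XYA : X *m A = Y *m A.
  by rewrite -X4 -[in LHS]Y1 -mulmxA mulmxA conjtrmxM X4 Y4 -mulmxA (mulmxA A) X1.
by rewrite -X2 XYA -mulmxA AXY mulmxA.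
Qed.

Lemma mpinvP (p q : nat) (A : 'M[C]_(p, q)) : is_mpinv A (mpinv A).
Proof. exact: (@xgetPex _ 0 [set X | is_mpinv A X]%classic (mpinv_exists A)). Qed.

Lemma drazin_exists (n : nat) (A : 'M[C]_n) : exists X, is_drazin A X.
Proof.
have [rk _] := mxindexP A; rewrite /is_drazin; set k := mxindex A in rk *.
have [W AW] : exists W, A ^+ k = W * A ^+ k.+1.
  have sub : (A ^+ k.+1 <= A ^+ k)%MS by rewrite exprS submxMl.
  by apply/submxP; rewrite -(geq_leqif (mxrank_leqif_sup sub)) rk.
have [V AV] : exists V, A ^+ k = A ^+ k.+1 * V.
  have sub : ((A ^+ k.+1)^T <= (A ^+ k)^T)%MS.
    by rewrite exprSr trmx_mul submxMl.
  have /submxP[V AV] : ((A ^+ k)^T <= (A ^+ k.+1)^T)%MS.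
    by rewrite -(geq_leqif (mxrank_leqif_sup sub)) !mxrank_tr rk.
  by exists V^T; apply: trmx_inj; rewrite AV trmx_mul trmxK.
have AWj j : A ^+ k = W ^+ j * A ^+ (j + k).
  elim: j => [|j IHj]; first by rewrite mul1r.
  rewrite {1}IHj addnC exprD {1}AW !mulrA -exprSr -mulrA -exprD.
  by rewrite addSn addnC.
have AVj j : A ^+ k = A ^+ (k + j) * V ^+ j.
  elim: j => [|j IHj]; first by rewrite addn0 mulr1.
  rewrite {1}IHj addnC exprD {1}AV mulrA -exprD -mulrA -exprS.
  by rewrite !addnS addnC.
pose U := W ^+ k.+1; pose B := A ^+ (k.+1 + k).
have UB : A ^+ k = U * B := AWj k.+1.
have BV : A ^+ k = B * V ^+ k.+1 by rewrite /B addnC; apply: AVj.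
set V' := V ^+ k.+1 in BV.
have cB j : A ^+ j * B = B * A ^+ j by rewrite /B -!exprD addnC.
have UV : U * A ^+ k = A ^+ k * V' by rewrite {1}BV UB mulrA.
have cA : A * A ^+ k = A ^+ k * A by rewrite -exprS -exprSr.
have AX : A * (U * A ^+ k) = U * A ^+ k * A.
  rewrite -[RHS]mulrA -cA [in RHS]BV UV mulrA cA.
  by rewrite [in LHS]UB -(expr1 A) -!mulrA (mulrA (A ^+ 1)) cB !mulrA.
have XAk : U * A ^+ k * A ^+ k.+1 = A ^+ k.
  by rewrite -mulrA -exprD addnC -/B -UB.
exists (U * A ^+ k); rewrite !mulmxE; split=> //.
by rewrite {2}UV mulrA -(mulrA _ A) -exprS XAk UV.
Qed.

Lemma drazin_unique (n : nat) (A : 'M[C]_n) X Y :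
  is_drazin A X -> is_drazin A Y -> X = Y.
Proof.
rewrite /is_drazin !mulmxE; set k := mxindex A => -[X1 X2 X3] [Y1 Y2 Y3].
have idem Z : Z * A * Z = Z -> forall j, (Z * A) ^+ j.+1 = Z * A.
  move=> ZAZ; elim=> [|j IHj]; first by rewrite expr1.
  by rewrite exprS IHj !mulrA ZAZ.
have absorb Z T : Z * A * Z = Z -> A * Z = Z * A -> A * T = T * A ->
    T * A ^+ k.+1 = A ^+ k -> Z * A = Z * A * (T * A).
  move=> Z1 Z2 T2 T3.
  have cZ : GRing.comm Z A by rewrite /GRing.comm Z2.
  have cT : T * A ^+ k.+1 = A ^+ k.+1 * T by apply: commrX.
  rewrite -(idem _ Z1 k) exprMn_comm // -mulrA; congr (_ * _).
  by rewrite mulrA -cT T3 -exprSr.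
have absorb' Z T : Z * A * Z = Z -> A * Z = Z * A ->
    T * A ^+ k.+1 = A ^+ k -> Z * A = T * A * (Z * A).
  move=> Z1 Z2 T3.
  have cZ : GRing.comm A Z by [].
  rewrite -(idem _ Z1 k) -Z2 exprMn_comm // mulrA; congr (_ * _).
  by rewrite -mulrA -exprS [in RHS]exprSr mulrA T3 -exprSr.
have XYA : X * A = Y * A.
  by rewrite (absorb' X Y) // [in RHS](absorb Y X).
by rewrite -X1 XYA -mulrA X2 XYA -Y2 mulrA Y1.
Qed.

Lemma drazinP (n : nat) (A : 'M[C]_n) : is_drazin A (drazin A).
Proof. exact: (@xgetPex _ 0 [set X | is_drazin A X]%classic (drazin_exists A)). Qed.

Lemma mweak_group_mp_exists (m n : nat) (A : 'M[C]_n) :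
  exists Y, is_mweak_group_mp m A Y.
Proof.
have [D1 D2 D3] := drazinP A; have [P1 _ _ _] := mpinvP (A ^+ mxindex A).
have [M1 M2 _ _] := mpinvP A.
rewrite /is_mweak_group_mp /mweak_A1 /mweak_group /core_ep; move: D1 D2 D3 P1 M1 M2; rewrite !mulmxE.
set k := mxindex A; set D := drazin A; set P := mpinv (A ^+ k).
set M := mpinv A => D1 D2 D3 P1 M1 M2.
set E := D * A ^+ k * P.
have DAk : D * A * A ^+ k = A ^+ k by rewrite -mulrA -exprS.
have cDA : D * A ^+ k = A ^+ k * D by apply: commrX.
have DAE : D * A * E = E by rewrite /E !mulrA D1.
have DP : D * A ^+ k * P * A ^+ k = D * A ^+ k.
  by rewrite -2!(mulrA D) P1.
have EAE : E * A * E = E.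
  by rewrite {2}/E !mulrA -(mulrA E A D) D2 -(mulrA E) DAk /E DP.
have AEE : A * E * E = E.
  have -> : A * E = A ^+ k * P by rewrite /E !mulrA D2 DAk.
  by rewrite /E cDA !mulrA P1.
have AEj j : A ^+ j.+1 * E ^+ j.+1 = A * E.
  elim: j => [|j IHj]; first by rewrite !expr1.
  by rewrite exprS (exprSr E) -mulrA (mulrA _ _ E) IHj AEE.
set G := E ^+ m.+1 * A ^+ m.
have GAG : G * A * G = G.
  rewrite /G !mulrA -(mulrA _ (A ^+ m) A) -exprSr -(mulrA _ (A ^+ m.+1)) AEj.
  by rewrite [in LHS]exprSr mulrA -(mulrA _ E A) -(mulrA _ _ E) EAE -exprSr.
have DAG : D * A * G = G by rewrite /G mulrA exprS mulrA DAE.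
clearbody G; exists (G * A * M); split.
- by rewrite -!mulrA (mulrA A M) (mulrA (A * M)) M1 !mulrA GAG.
- by rewrite !mulrA.
- by rewrite -!mulrA (mulrA A M) M1 !mulrA DAG.
Qed.

Lemma mweak_group_mp_unique (m n : nat) (A Y Z : 'M[C]_n) :
  is_mweak_group_mp m A Y -> is_mweak_group_mp m A Z -> Y = Z.
Proof.
move=> [Y1 Y2 Y3] [Z1 Z2 Z3].
by rewrite -Y1 Y3 -Z3 -mulmxA Y2 -Z2 mulmxA Z1.
Qed.

Lemma mweak_group_mpP (m n : nat) (A : 'M[C]_n) :
  is_mweak_group_mp m A (mweak_group_mp m A).
Proof. exact: (@xgetPex _ 0 [set Y | is_mweak_group_mp m A Y]%classic (mweak_group_mp_exists m A)). Qed.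

End GeneralizedInverses.

(* Main.v *)
Require Import Defs.
From mathcomp Require Import all_boot all_order all_algebra spectral.
From mathcomp Require Import reals complex.

(** Write [G] for the m-weak group inverse of [A], [M] for its Moore-Penrose
    inverse, [D] for its Drazin inverse, and let [k] be the index of [A].

    Everything rests on two facts about [G]: its columns lie in the range of
    [A ^+ k] ([mweak_group_factor]), and [G * A] is the identity on that range
    ([mweak_group_fix]).  They make [G] an outer inverse of [A], they give
    [D * A1 = G * A], and they give [A1 ^+ k = A ^+ k * G * A].

    Since [D * A1 = G * A], condition (a) says that [X] is an outer inverse of
    [A] with [A X = A1 M] and [X A = G A]; such an [X] is [G A M].  Each of the
    conditions (b) to (e) weakens one of the two last equations by a
    multiplication, and the equation comes back as follows.
    - (b), (e): the Moore-Penrose equations cancel a factor [A^t*] standing next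
      to [A] ([mul_conjtrmx_cancelr], [mul_conjtrmx_cancell]).
    - (c): [X A = X (A X) A = X A G A], where [A G A] has its columns in the
      range of [A ^+ k], on which [X] and [G] agree.
    - (d): [X = G A X] and [G A M] both have their columns in the range of
      [A ^+ k], on which [A ^+ k] is injective because [k] is the index
      ([mul_expr_mxindex_inj]); so [A ^+ k * X = A ^+ k * (G A M)] forces
      [X = G A M].
    All the arguments hold for [k = 0], where [A] is invertible. *)

Set Implicit Arguments.
Unset Strict Implicit.
Unset Printing Implicit Defensive.

Import GRing.Theory.

Local Open Scope sesquilinear_scope.
Local Open Scope ring_scope.

Section MoorePenrose.

Variables (C : numClosedFieldType) (p q : nat) (A : 'M[C]_(p, q)).

(** The adjoint of [mpinv A] undoes the factor, since
    [A *m (mpinv A *m A)^t* = A *m mpinv A *m A = A]. *)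
Lemma mul_conjtrmx_cancelr (r : nat) (U V : 'M[C]_(r, p)) :
  U *m A *m A^t* = V *m A *m A^t* -> U *m A = V *m A.
Proof.
have [M1 _ _ M4] := mpinvP A.
have AAM : A *m A^t* *m (mpinv A)^t* = A.
  by rewrite -mulmxA -conjtrmxM M4 mulmxA.
move=> /(congr1 (mulmx^~ ((mpinv A)^t*))).
by rewrite /= -!mulmxA ![A *m (_ *m _)]mulmxA AAM.
Qed.

(** Dual of [mul_conjtrmx_cancelr], by
    [(A *m mpinv A)^t* *m A = A *m mpinv A *m A = A]. *)
Lemma mul_conjtrmx_cancell (r : nat) (U V : 'M[C]_(q, r)) :
  A^t* *m A *m U = A^t* *m A *m V -> A *m U = A *m V.
Proof.
have [M1 _ M3 _] := mpinvP A.
have MAA : (mpinv A)^t* *m A^t* *m A = A.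
  by rewrite -conjtrmxM M3.
move=> /(congr1 (mulmx ((mpinv A)^t*))).
by rewrite !mulmxA MAA.
Qed.

End MoorePenrose.

Section WeakGroupInverse.

Variables (C : numClosedFieldType) (m n : nat) (A : 'M[C]_n).

Local Notation k := (mxindex A).
Local Notation D := (drazin A).
Local Notation M := (mpinv A).
Local Notation G := (mweak_group m A).
Local Notation A1 := (mweak_A1 m A).

Lemma mweak_A1E : A1 = A * (G * A).
Proof. by rewrite mulrA. Qed.

Lemma drazin_fix : D * A * A ^+ k = A ^+ k.
Proof. by have [_ _ D3] := drazinP A; rewrite -mulrA -exprS. Qed.

Lemma drazin_expr_mxindex : D * A ^+ k = A ^+ k * D.
Proof. by have [_ D2 _] := drazinP A; apply: commrX. Qed.

(** [D ^+ j] is a left inverse of [A ^+ j] on the range of [A ^+ k]. *)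
Lemma mul_expr_mxindex_inj (j : nat) (U V : 'M[C]_n) :
  A ^+ j * (A ^+ k * U) = A ^+ j * (A ^+ k * V) -> A ^+ k * U = A ^+ k * V.
Proof.
have DAj : D ^+ j * A ^+ (k + j) = A ^+ k.
  elim: j => [|j IHj]; first by rewrite mul1r addn0.
  rewrite -[RHS]IHj exprSr -mulrA; congr (_ * _).
  by rewrite addnS -addSn exprD exprS !mulrA drazin_fix -exprD.
move=> /(congr1 ( *%R (D ^+ j))).
by rewrite !(mulrA (A ^+ j)) -exprD addnC !mulrA DAj.
Qed.

(** The core-EP inverse inverts [A] on the range of [A ^+ k], because
    [A ^+ k * mpinv (A ^+ k)] is the projector onto that range. *)
Lemma core_ep_mul_expr : core_ep A * A ^+ k.+1 = A ^+ k.
Proof.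
have [P1 _ _ _] := mpinvP (A ^+ k); have [_ _ D3] := drazinP A.
rewrite /core_ep !mulmxE in P1 D3 *.
by rewrite exprSr mulrA -2!(mulrA D) P1 -mulrA -exprSr.
Qed.

Lemma mweak_group_fix : G * A * A ^+ k = A ^+ k.
Proof.
have EA j : core_ep A ^+ j * A ^+ (j + k) = A ^+ k.
  elim: j => [|j IHj]; first by rewrite mul1r.
  rewrite exprSr addSn -addnS addnC exprD -mulrA (mulrA (core_ep A)).
  by rewrite core_ep_mul_expr -exprD addnC.
rewrite /mweak_group mulmxE -(mulrA _ (A ^+ m)) -exprSr -mulrA -exprD.
exact: EA.
Qed.

Lemma mweak_group_factor : exists Z, G = A ^+ k * Z.
Proof.
exists (D * mpinv (A ^+ k) * core_ep A ^+ m * A ^+ m).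
rewrite /mweak_group exprS {1}/core_ep !mulmxE.
by rewrite drazin_expr_mxindex !mulrA.
Qed.

(** A power of [A] maps the range of [A ^+ k] into itself. *)
Lemma mweak_group_fix_expr (j : nat) (Z : 'M[C]_n) :
  G * A * (A ^+ j * (G * Z)) = A ^+ j * (G * Z).
Proof.
have [W GE] := mweak_group_factor.
have -> : A ^+ j * (G * Z) = A ^+ k * (A ^+ j * (W * Z)).
  by rewrite GE !mulrA -!exprD addnC.
by rewrite mulrA mweak_group_fix.
Qed.

Lemma mweak_group_outer : G * A * G = G.
Proof. by have := mweak_group_fix_expr 0 1; rewrite mul1r !mulr1. Qed.

Lemma drazin_mweak_A1 : D * A1 = G * A.
Proof.
have [Z GE] := mweak_group_factor.
by rewrite mweak_A1E GE !mulrA drazin_fix.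
Qed.

(** In [A1 * A1 = A (G A) (A G A)] the first [G A] fixes the columns of
    [A G A], so that only the last [G] survives.  For [k = 0] the formula
    reads [1 = G * A], true because [A] is then invertible with inverse [G]. *)
Lemma mweak_A1_expr : A1 ^+ k = A ^+ k * (G * A).
Proof.
have A1S j : A1 ^+ j.+1 = A ^+ j.+1 * (G * A).
  elim: j => [|j IHj]; first by rewrite !expr1 mweak_A1E.
  by rewrite exprS IHj mweak_A1E -mulrA mweak_group_fix_expr mulrA -exprS.
have := mweak_group_fix; case: k => [|j] /=; last by rewrite A1S.
by rewrite !expr0 mulr1 mul1r => ->.
Qed.

(** The second and third equations pin down [X], as [X = (X A) X = G (A X)]. *)
Lemma outer_inverse_eq (X : 'M[C]_n) :
  X * A * X = X -> A * X = A1 * M -> X * A = G * A -> X = G * A * M.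
Proof.
move=> X1 X2 X3; rewrite -X1 X3 -mulrA X2 mweak_A1E.
(* [G] is generalized so that [mulrA] cannot rewrite inside its body. *)
by move: (G) (mweak_group_outer) => W GAG; rewrite !mulrA GAG.
Qed.

Lemma is_mweak_group_mpE (X : 'M[C]_n) :
  is_mweak_group_mp m A X <-> [/\ X * A * X = X, A * X = A1 * M & X * A = G * A].
Proof. by rewrite /is_mweak_group_mp !mulmxE drazin_mweak_A1. Qed.

Lemma eq_mweak_group_mp (X : 'M[C]_n) :
  X = mweak_group_mp m A <->
  [/\ X * A * X = X, A * X = A1 * M & X * A = G * A].
Proof.
split=> [->|/is_mweak_group_mpE XP].
  exact/is_mweak_group_mpE/mweak_group_mpP.
exact: mweak_group_mp_unique XP (mweak_group_mpP m A).
Qed.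

(** [A ^+ k = A * (A ^+ k * D)] covers [k = 0] as well as [k > 0]. *)
Lemma mul_expr_of_mul (U V : 'M[C]_n) :
  U * A = V * A -> U * A ^+ k = V * A ^+ k.
Proof.
have AkE : A ^+ k = A * (A ^+ k * D).
  have [_ D2 _] := drazinP A; rewrite !mulmxE in D2.
  by rewrite -drazin_expr_mxindex mulrA D2 drazin_fix.
by move=> UV; rewrite AkE !mulrA UV.
Qed.

Lemma mul_of_mul_expr (X : 'M[C]_n) :
  X * A * X = X -> A * X = A1 * M -> X * A ^+ k = G * A ^+ k -> X * A = G * A.
Proof.
have [M1 _ _ _] := mpinvP A; rewrite !mulmxE in M1 => X1 X2 X3.
have XA : X * A = X * (A * (G * A)).
  rewrite -{1}X1 -(mulrA X A X) X2 mweak_A1E -!mulrA.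
  by rewrite (mulrA A M A) M1.
have [Z GE] := mweak_group_factor.
have AGA : A * (G * A) = A ^+ k * (A * (Z * A)).
  by rewrite GE !mulrA -exprS -exprSr.
by rewrite XA AGA mulrA X3 -mulrA -AGA mulrA [LHS]mulrA mweak_group_outer.
Qed.

Lemma eq_of_expr_mul (X : 'M[C]_n) :
  X * A * X = X -> X * A = G * A -> A ^+ k * X = A1 ^+ k * M -> X = G * A * M.
Proof.
have [Z GE] := mweak_group_factor; move=> X1 X2.
have XE : X = A ^+ k * (Z * (A * X)) by rewrite mulrA -GE mulrA -X2 X1.
have YE : G * A * M = A ^+ k * (Z * A * M) by rewrite GE !mulrA.
rewrite mweak_A1_expr -mulrA YE XE; exact: mul_expr_mxindex_inj.
Qed.

End WeakGroupInverse.

Theorem theorem4p2 (R : realType) (n k m : nat) (A X : 'M[R[i]]_n)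
  (hk : mxindex A = k) (hm : (0 < m)%N) :
  [<-> X = mweak_group_mp m A;
       [/\ X *m A *m X = X, A *m X = mweak_A1 m A *m mpinv A
         & X *m A *m A^t* = mweak_group m A *m A *m A^t*];
       [/\ X *m A *m X = X, A *m X = mweak_A1 m A *m mpinv A
         & X *m A ^+ k = mweak_group m A *m A ^+ k];
       [/\ X *m A *m X = X, X *m A = mweak_group m A *m A
         & A ^+ k *m X = mweak_A1 m A ^+ k *m mpinv A];
       [/\ X *m A *m X = X, X *m A = mweak_group m A *m A
         & A^t* *m A *m X = A^t* *m mweak_A1 m A *m mpinv A]].
Proof.
have A1M : mweak_A1 m A *m mpinv A = A *m (mweak_group m A *m A *m mpinv A).
  by rewrite mweak_A1E -!mulmxE !mulmxA.
rewrite -hk; tfae.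
- move/eq_mweak_group_mp => [X1 X2 X3]; split=> //.
  by rewrite !mulmxE X3.
- case=> X1 X2 /mul_conjtrmx_cancelr X3; split=> //.
  exact: mul_expr_of_mul.
- case=> X1 X2 X3; have XA := mul_of_mul_expr X1 X2 X3; split=> //.
  by rewrite {1}(outer_inverse_eq X1 X2 XA) mweak_A1_expr !mulmxE !mulrA.
- case=> X1 X2 X3; split=> //.
  by rewrite -[RHS]mulmxA -[LHS]mulmxA A1M {1}(eq_of_expr_mul X1 X2 X3).
- case=> X1 X2; rewrite -[RHS]mulmxA A1M mulmxA => /mul_conjtrmx_cancell X3.
  by apply/eq_mweak_group_mp; split; rewrite -?mulmxE ?A1M.
Qed.
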